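(* Let $L_1$ and $L_2$ be finite groups of the same order. If there exist $N_1\trianglelefteq L_1$ and $N_2\trianglelefteq L_2$ such that $N_1\cong N_2$, and both $L_1/N_1$ and $L_2/N_2$ are nilpotent, then $L_1$ and $L_2$ are compatible. In particular, finite nilpotent groups of the same order are compatible.
   Context: Two finite groups $L_1,L_2$ are compatible if there exists a finite group $G$ with isomorphic normal subgroups $M_1\cong M_2$ such that $L_1\cong G/M_1$ and $L_2\cong G/M_2$. *)

(* Defs.v *)
From mathcomp Require Import all_boot all_fingroup all_solvable.

Set Implicit Arguments.
Unset Strict Implicit.
Unset Printing Implicit Defensive.

Local Open Scope group_scope.

Definition compatible (gT1 gT2 : finGroupType)
    (L1 : {group gT1}) (L2 : {group gT2}) : Prop :=
  exists (gT : finGroupType) (G M1 M2 : {group gT}),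
    [/\ M1 <| G, M2 <| G, M1 \isog M2, L1 \isog G / M1 & L2 \isog G / M2].

(* Main.v *)
Require Import Defs.
From mathcomp Require Import all_boot all_fingroup all_solvable.

(** The heart of the matter is that compatibility lifts along extensions: if
    [H1], [H2] are isomorphic normal subgroups of [L1], [L2] and [L1 / H1],
    [L2 / H2] are compatible, then so are [L1] and [L2]. Let [G] witness the
    latter, with kernels [M1], [M2], let [X] be the fibre product of [L1], [G]
    and [L2], and let [A1], [A2] be the kernels of [X -> L1 / H1] and
    [X -> L2 / H2]; both map onto [T = M2 x H2]. Replace [X] by the group [C] of
    words in its elements modulo those that are trivial in [G] and in every
    [X]-labelling of the Cayley graph of [G], that is by [F / V(R)] for [F] free
    on [X], [R] the kernel of [F -> G] and [V] the verbal subgroup of the laws of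
    [X]. By Schreier's theorem the preimages of [A1] and [A2] in [F] are free of
    the same rank, and Gaschütz's lemma yields an isomorphism between their
    images in [C] which is compatible with the maps to [T]. It restricts to an
    isomorphism between the kernels of [C -> L1] and [C -> L2].

    Nilpotent groups of the same order are then treated by induction, dividing
    out central subgroups of the same prime order. *)

Set Implicit Arguments.
Unset Strict Implicit.
Unset Printing Implicit Defensive.

Local Open Scope group_scope.

(** * Counting generating lifts: Gaschütz's lemma *)

Section Gaschutz.

Variables (gT hT : finGroupType) (D : {group gT}) (f : {morphism D >-> hT}).

Definition lifts (I : finType) (E : {set gT}) (t : I -> hT) :=
  [set e : {ffun I -> gT} | [forall i, (e i \in E) && (f (e i) == t i)]].

Definition gen_lifts (I : finType) (E : {set gT}) (t : I -> hT) :=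
  [set e in lifts E t | <<[set e i | i : I]>> == E].

Lemma card_lifts (I : finType) (E : {group gT}) (t : I -> hT) :
  E \subset D -> (forall i, t i \in f @* E) ->
  #|lifts E t| = (#|'ker_E f| ^ #|I|)%N.
Proof.
move=> sED tE.
pose F i := [pred x | (x \in E) && (f x == t i)].
have -> : #|lifts E t| = #|family F|.
  apply: eq_card => e; rewrite inE; apply/forallP/familyP => h i; exact: h.
have cF i : #|F i| = #|'ker_E f|.
  case/morphimP: (tE i) => x Dx Ex tx.
  rewrite -(card_rcoset ('ker_E f) x); apply: eq_card => y.
  rewrite inE tx mem_rcoset inE.
  rewrite groupMr ?groupV //; case Ey: (y \in E) => //=.
  have Dy := subsetP sED y Ey.
  by rewrite !inE groupM ?groupV //= morphM ?groupV // morphV // -eq_mulgV1.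
by rewrite card_family foldrE big_image /= (eq_bigr _ (fun i _ => cF i)) prod_nat_const.
Qed.

(** Sort the lifts by the subgroup they generate; it maps onto [f @* E] because its image contains
    the generating family [t]. *)
Lemma card_lifts_gen (I : finType) (E : {group gT}) (t : I -> hT) :
  E \subset D -> <<[set t i | i : I]>> = f @* E ->
  #|lifts E t| = (\sum_(E1 : {group gT} | (E1 \subset E) && (f @* E1 == f @* E))
                    #|gen_lifts E1 t|)%N.
Proof.
move=> sED gt; pose g (e : {ffun I -> gT}) := <<[set e i | i : I]>>%G.
rewrite -sum1_card (partition_big g (fun E1 => (E1 \subset E) && (f @* E1 == f @* E))).
  apply: eq_bigr => E1 /andP[sE1 _]; rewrite -sum1_card; apply: eq_bigl => e.
  rewrite !inE -val_eqE /=; case: eqP => [gE1|]; rewrite ?andbF // !andbT.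
  apply/forallP/forallP => h i; have /andP[e1 ->] := h i; rewrite andbT.
    by rewrite -gE1 mem_gen // imset_f.
  exact: (subsetP sE1).
move=> e; rewrite inE => /forallP h.
have sgE : g e \subset E.
  rewrite gen_subG; apply/subsetP=> _ /imsetP[i _ ->]; by case/andP: (h i).
rewrite sgE eqEsubset morphimS //= -gt gen_subG.
apply/subsetP=> _ /imsetP[i _ ->]; have /andP[Ee /eqP <-] := h i.
apply: mem_morphim; first exact: (subsetP sED).
by apply: mem_gen; apply: imset_f.
Qed.

(** Strong induction on [#|E|]: both families have equally many lifts, and in [card_lifts_gen] the
    terms of proper subgroups agree by induction, so the remaining terms, those of [E], agree
    too. *)
Lemma card_gen_lifts_eq (I1 I2 : finType) (E : {group gT})
    (t1 : I1 -> hT) (t2 : I2 -> hT) :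
    E \subset D -> #|I1| = #|I2| ->
    <<[set t1 i | i : I1]>> = f @* E -> <<[set t2 i | i : I2]>> = f @* E ->
  #|gen_lifts E t1| = #|gen_lifts E t2|.
Proof.
move=> sED cI; have [n] := ubnP #|E|; elim: n E sED => // n IHn E sED /ltnSE leEn g1 g2.
have c1 := card_lifts_gen sED g1; have c2 := card_lifts_gen sED g2.
have : #|lifts E t1| = #|lifts E t2|.
  by rewrite !card_lifts ?cI // => i; [rewrite -g2 | rewrite -g1];
    apply: mem_gen; apply: imset_f.
rewrite c1 c2 (bigD1 E) ?subxx ?eqxx //= [RHS](bigD1 E) ?subxx ?eqxx //=.
set s1 := (\sum_(i | _) _)%N; set s2 := (\sum_(i | _) _)%N.
suff -> : s1 = s2 by move/addIn.
apply: eq_bigr => E1 /andP[/andP[sE1 /eqP fE1] nE1].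
apply: IHn; rewrite ?fE1 ?(subset_trans sE1) //.
apply: leq_trans leEn; apply: proper_card.
by rewrite properEneq sE1 andbT; apply: contraNneq nE1 => eE; apply/eqP/val_inj.
Qed.

(* Gaschütz's lemma, with a generating family of [E] of the right size in place
   of a bound on its rank: the number of generating lifts does not depend on the
   family being lifted. *)
Lemma gaschutz (I1 I2 : finType) (E : {group gT}) (e2 : I2 -> gT) (t : I1 -> hT) :
    E \subset D -> #|I1| = #|I2| -> <<[set e2 i | i : I2]>> = E ->
    <<[set t i | i : I1]>> = f @* E ->
  exists e1 : I1 -> gT, <<[set e1 i | i : I1]>> = E /\ forall i, f (e1 i) = t i.
Proof.
move=> sED cI ge2 gt.
have Ee2 i : e2 i \in E by rewrite -ge2 mem_gen // imset_f.
have gt2 : <<[set f (e2 i) | i : I2]>> = f @* E.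
  rewrite -[gval E in RHS]ge2 morphim_gen; last first.
    by apply/subsetP=> _ /imsetP[i _ ->]; apply: (subsetP sED).
  congr <<_>>; apply/setP=> x.
  apply/imsetP/morphimP => [[i _ ->]|[y _ /imsetP[i _ ->] ->]].
    by exists (e2 i); rewrite ?imset_f // (subsetP sED).
  by exists i.
(* [e2] is itself a generating lift of its image family, so the common number of generating lifts is
   positive. *)
have /card_gt0P[e] : 0 < #|gen_lifts E t|.
  rewrite (card_gen_lifts_eq sED cI gt gt2); apply/card_gt0P; exists (finfun e2).
  rewrite !inE; apply/andP; split.
    by apply/forallP=> i; rewrite ffunE Ee2 eqxx.
  by rewrite (eq_imset _ (ffunE e2)) ge2.
rewrite !inE => /andP[/forallP he /eqP ge]; exists e; split=> // i.
by case/andP: (he i) => _ /eqP.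
Qed.

End Gaschutz.

(** * Words in [X] acting on labelled Cayley graphs *)

Section Cover.

Variables (X gT : finGroupType) (p : {morphism [set: X] >-> gT}).

Let pM x y : p (x * y) = p x * p y. Proof. by rewrite morphM ?inE. Qed.

Definition labelling := {ffun gT * X -> X}.
Definition cover_state := (labelling * gT * X)%type.

(* A state consists of a labelling of the edges of the Cayley graph of [gT], a
   vertex and an accumulator: reading [s] follows the edge [s] and multiplies the
   accumulator by its label. *)
Definition cover_step (s : X) (v : cover_state) : cover_state :=
  (v.1.1, v.1.2 * p s, v.2 * v.1.1 (v.1.2, s)).

Lemma cover_step_inj s : injective (cover_step s).
Proof.
move=> [[c x] n] [[d y] m] [/= -> /mulIg -> /mulIg ->]; by [].
Qed.

Definition letter s := perm (@cover_step_inj s).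

Definition word_eval (w : seq X) := \prod_(s <- w) letter s.
Definition word_prod (w : seq X) := \prod_(s <- w) s.

Fixpoint word_label (c : labelling) (x : gT) (w : seq X) :=
  if w is s :: w' then c (x, s) * word_label c (x * p s) w' else 1.

Lemma word_eval_cons s w : word_eval (s :: w) = letter s * word_eval w.
Proof. exact: big_cons. Qed.

Lemma word_eval_cat w1 w2 : word_eval (w1 ++ w2) = word_eval w1 * word_eval w2.
Proof. exact: big_cat. Qed.

Lemma word_prod_cons s w : word_prod (s :: w) = s * word_prod w.
Proof. exact: big_cons. Qed.

Lemma word_prod_cat w1 w2 : word_prod (w1 ++ w2) = word_prod w1 * word_prod w2.
Proof. exact: big_cat. Qed.

Lemma word_evalE w c x n :
  word_eval w (c, x, n) = (c, x * p (word_prod w), n * word_label c x w).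
Proof.
elim: w x n => [|s w IHw] x n.
  by rewrite /word_eval /word_prod !big_nil perm1 morph1 !mulg1.
by rewrite word_eval_cons word_prod_cons permM permE IHw pM !mulgA.
Qed.

Definition word_group := <<[set letter s | s : X]>>%G.

(** In a finite group inverses are positive powers, so words need no inverse letters. *)
Lemma word_groupP a : reflect (exists w, a = word_eval w) (a \in word_group).
Proof.
apply: (iffP idP) => [/gen_prodgP[n [e eL ->]] | [w ->]].
  have /fin_all_exists[f fE] i : exists s, e i = letter s.
    by have /imsetP[s _ ->] := eL i; exists s.
  exists [seq f i | i <- index_enum 'I_n]; rewrite /word_eval big_map.
  exact: eq_bigr.
by apply: group_prod => s _; rewrite mem_gen // imset_f.
Qed.

Definition cover_label (a : {perm cover_state}) c x := (a (c, x, 1)).2.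

Lemma cover_label_word w c x : cover_label (word_eval w) c x = word_label c x w.
Proof. by rewrite /cover_label word_evalE mul1g. Qed.

(* The labelling of every edge by its own letter recovers the product in [X]. *)
Definition cover_val a := cover_label a [ffun u => u.2] 1.

Lemma cover_val_word w : cover_val (word_eval w) = word_prod w.
Proof.
rewrite /cover_val cover_label_word; elim: w 1 => [|s w IHw] x /=.
  by rewrite /word_prod big_nil.
by rewrite word_prod_cons ffunE IHw.
Qed.

Lemma cover_valM : {in word_group &, {morph cover_val : a b / a * b}}.
Proof.
move=> a b /word_groupP[v ->] /word_groupP[w ->].
by rewrite -word_eval_cat !cover_val_word word_prod_cat.
Qed.

Canonical cover_val_morphism := Morphism cover_valM.

Lemma cover_valV : {in word_group, {morph cover_val : a / a^-1}}.
Proof. exact: (morphV cover_val_morphism). Qed.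

Lemma cover_labelM a b c x : a \in word_group -> b \in word_group ->
  cover_label (a * b) c x
    = cover_label a c x * cover_label b c (x * p (cover_val a)).
Proof.
case/word_groupP=> v -> /word_groupP[w ->].
by rewrite cover_val_word /cover_label permM !word_evalE /= !mul1g.
Qed.

(** An element moves the vertex by the image under [p] of its [cover_val], which is itself one of
    its labels; hence the labels determine the whole permutation. *)
Lemma eq_word_group a b : a \in word_group -> b \in word_group ->
  (forall c x, cover_label a c x = cover_label b c x) -> a = b.
Proof.
move=> /word_groupP[v ->] /word_groupP[w ->] eqvw; apply/permP=> -[[c x] n].
rewrite !word_evalE -!cover_label_word eqvw -!cover_val_word /cover_val.
by rewrite eqvw.
Qed.

Lemma letter_cover s : letter s \in word_group.
Proof. by rewrite mem_gen // imset_f. Qed.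

Lemma letter_word s : letter s = word_eval [:: s].
Proof. by rewrite /word_eval big_seq1. Qed.

Lemma cover_val_letter s : cover_val (letter s) = s.
Proof. by rewrite letter_word cover_val_word /word_prod big_seq1. Qed.

Lemma im_cover_val : cover_val @* word_group = [set: X].
Proof.
apply/setP=> s; rewrite inE; rewrite -(cover_val_letter s).
by rewrite mem_morphim ?letter_cover.
Qed.

End Cover.

(** * Coset representatives and the Schreier graph *)

Section Transversal.

Variables (X : finGroupType) (A : {group X}).

(** [repr] picks 1 in any set containing it, so 1 represents [A] and serves as the base point. *)
Definition rc_repr x := repr (A :* x).

Lemma mul_rc_reprV x : x * (rc_repr x)^-1 \in A.
Proof.
by rewrite -groupV invMg invgK -mem_rcoset; apply: mem_repr_rcoset.
Qed.

Lemma rc_reprM a x : a \in A -> rc_repr (a * x) = rc_repr x.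
Proof. by move=> Aa; rewrite /rc_repr rcosetM (rcoset_id Aa). Qed.

Lemma rc_reprMr x s : rc_repr (rc_repr x * s) = rc_repr (x * s).
Proof.
by rewrite -(rc_reprM (rc_repr x * s) (mul_rc_reprV x)) mulgA mulgKV.
Qed.

Lemma rc_repr_id x : rc_repr (rc_repr x) = rc_repr x.
Proof. by rewrite -[X in rc_repr X]mulg1 rc_reprMr mulg1. Qed.

Lemma rc_repr_in a : a \in A -> rc_repr a = 1.
Proof. by move=> Aa; rewrite /rc_repr rcoset_id ?repr_group. Qed.

Definition rc_reprs := [set rc_repr x | x : X].

Lemma card_rc_reprs : (#|rc_reprs| * #|A| = #|X|)%N.
Proof.
rewrite -cardsT -(Lagrange (subsetT A)) mulnC; congr (_ * _)%N.
have -> : rc_reprs = repr @: rcosets A [set: X].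
  apply/setP=> y; apply/imsetP/imsetP => [[x _ ->]|[_ /rcosetsP[x _ ->] ->]].
    by exists (A :* x); rewrite // mem_rcosets mulSGid ?subsetT // inE.
  by exists x.
apply: card_in_imset => _ _ /rcosetsP[x _ ->] /rcosetsP[y _ ->] eqr.
by rewrite -(rcoset_repr A x) eqr rcoset_repr.
Qed.

(* The edges of the Schreier graph of [A] outside its spanning star, whose edges
   join the base point to every other representative [s] by the letter [s]. *)
Definition schreier_edges :=
  setX rc_reprs [set: X] :\: setX [set 1] (rc_reprs :\ 1).

Lemma rc_reprs1 : 1 \in rc_reprs.
Proof. by apply/imsetP; exists 1; rewrite ?rc_repr_in. Qed.

Lemma schreier_edgesPn x s : (rc_repr x, s) \notin schreier_edges ->
  [/\ rc_repr x = 1, rc_repr s = s & s != 1].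
Proof.
rewrite !inE negb_and negbK !andbT /= imset_f ?inE // orbF.
case/and3P=> /eqP -> s1 /imsetP[y _ sE]; split=> //.
by rewrite sE rc_repr_id.
Qed.

(** Schreier's formula for the rank of the preimage of [A] in the free group on [X]. It depends on
    [A] only through its index, which lets the edges of two subgroups of equal order be matched. *)
Lemma card_schreier_edges :
  #|schreier_edges| = (#|rc_reprs| * #|X| - #|rc_reprs|.-1)%N.
Proof.
rewrite /schreier_edges cardsD (setIidPr _) ?cardsX ?cardsT ?cards1 ?mul1n.
  by rewrite (cardsD1 1 rc_reprs) rc_reprs1.
by apply: setXS; rewrite ?subsetT // sub1set rc_reprs1.
Qed.

End Transversal.

(** * Schreier generators of preimages *)

Section CoverPreimage.

Variables (X gT : finGroupType) (p : {morphism [set: X] >-> gT}).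

Local Notation val := (cover_val_morphism p).
Local Notation edge A := {j : X * X | j \in schreier_edges A}.

Definition cover_pre (A : {group X}) := (val @*^-1 A)%G.

Lemma cover_preE (A : {group X}) a :
  (a \in cover_pre A) = (a \in word_group p) && (cover_val a \in A).
Proof. by rewrite !inE. Qed.

Lemma sub_cover_pre (A : {group X}) : cover_pre A \subset word_group p.
Proof. exact: subsetIl. Qed.

Lemma card_cover_pre (A : {group X}) : #|cover_pre A| = (#|'ker val| * #|A|)%N.
Proof. by rewrite card_morphpre // im_cover_val subsetT. Qed.

(** Schreier's lemma: a generator runs along the star to the start of an edge, follows the edge, and
    returns along the star. *)
Lemma gen_cover_pre (A : {group X}) :
  exists e : edge A -> {perm cover_state X gT},
    <<[set e j | j : edge A]>> = cover_pre A.
Proof.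
(* The star path from the base point to the coset of [q]. It is empty at the base point, since the
   letter of 1 need not act trivially. *)
pose u q := if rc_repr A q == 1 then 1 else letter p (rc_repr A q).
have uG q : u q \in word_group p.
  by rewrite /u; case: ifP => _; rewrite ?group1 ?letter_cover.
have vu q : cover_val (u q) = rc_repr A q.
  by rewrite /u; case: eqP => [->|_]; rewrite ?cover_val_letter ?(morph1 val).
pose y j := u j.1 * letter p j.2 * (u (j.1 * j.2))^-1.
exists (fun j => y (sval j)); apply/eqP; rewrite eqEsubset gen_subG; apply/andP; split.
  apply/subsetP=> _ /imsetP[[[q s] /= jA] _ ->]; rewrite cover_preE /y /=.
  have /imsetP[x _ qx] : q \in rc_reprs A by move: jA; rewrite !inE => /and3P[].
  apply/andP; split; first by rewrite !groupM ?groupV ?uG ?letter_cover.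
  have -> : cover_val (u q * letter p s * (u (q * s))^-1)
      = q * s * (rc_repr A (q * s))^-1.
    rewrite !(@cover_valM _ _ p) ?(@cover_valV _ _ p) ?groupM ?groupV
            ?uG ?letter_cover //.
    by rewrite !vu cover_val_letter qx rc_repr_id.
  exact: mul_rc_reprV.
set Y := <<_>>.
(* By telescoping, such a loop is a product of Schreier generators, those of star edges being
   trivial. For [q = 1] and a product in [A], both connecting paths are empty. *)
have uY w q : u q * word_eval p w * (u (q * word_prod w))^-1 \in Y.
  elim: w q => [|s w IHw] q.
    by rewrite /word_eval /word_prod !big_nil !mulg1 mulgV group1.
  rewrite word_eval_cons word_prod_cons mulgA.
  have ur x : u (rc_repr A x) = u x by rewrite /u rc_repr_id.
  have yY : u q * letter p s * (u (q * s))^-1 \in Y.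
    have [jA|] := boolP ((rc_repr A q, s) \in schreier_edges A).
      apply: mem_gen; apply/imsetP; exists (Sub (rc_repr A q, s) jA) => //=.
      by rewrite /y /= ur -[u (rc_repr A q * s)]ur rc_reprMr ur.
    case/schreier_edgesPn=> q1 s1 n1.
    rewrite -[u (q * s)]ur -rc_reprMr q1 mul1g ur /u q1 eqxx s1 (negPf n1).
    by rewrite mul1g mulgV; apply: group1.
  move: (groupM yY (IHw (q * s))).
  by rewrite -!mulgA mulKg !mulgA; apply.
apply/subsetP=> a; rewrite cover_preE => /andP[/word_groupP[w ->]].
rewrite cover_val_word => Aw.
have := uY w 1; rewrite mul1g /u !rc_repr_in // eqxx mul1g invg1 mulg1; exact.
Qed.


End CoverPreimage.

(** * The isomorphism between the preimages of [A1] and [A2] *)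

Section CoverIso.

Variables (X gT tT : finGroupType) (p : {morphism [set: X] >-> gT}).
Variables (A1 A2 : {group X}).
Variables (t1 : {morphism A1 >-> tT}) (t2 : {morphism A2 >-> tT}).
Variables (T : {group tT}) (f : {morphism T >-> gT}).

Local Notation val := (cover_val_morphism p).
Local Notation edge A := {j : X * X | j \in schreier_edges A}.

Hypothesis card_A12 : #|A1| = #|A2|.
Hypotheses (im_t1 : t1 @* A1 = T) (im_t2 : t2 @* A2 = T).
Hypothesis kerp : forall r, p r = 1 -> r \in A1 /\ f (t1 r) = 1.
Hypothesis p_A2 : {in A2, forall a, p a = f (t2 a)}.

Let pM x y : p (x * y) = p x * p y. Proof. by rewrite morphM ?inE. Qed.

Lemma card_edges : #|{: edge A1}| = #|{: edge A2}|.
Proof.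
have cE (A : {group X}) : #|{: edge A}| = #|schreier_edges A|.
  by rewrite card_sig; apply: eq_card => j; rewrite inE.
suff eqc : #|rc_reprs A1| = #|rc_reprs A2| by rewrite !cE !card_schreier_edges eqc.
apply/eqP; rewrite -(eqn_pmul2r (cardG_gt0 A1)) {2}card_A12.
by rewrite !card_rc_reprs.
Qed.

Let a1 x s := rc_repr A1 x * s * (rc_repr A1 (x * s))^-1.

Let a1_in x s : a1 x s \in A1.
Proof. by rewrite /a1 -rc_reprMr mul_rc_reprV. Qed.

(* Tree edges get the value [1]; the others get lifts, supplied by [gaschutz], of
   the images in [tT] of the Schreier generators of [A1]. *)
Lemma cover_edges : exists h : X -> X -> {perm cover_state X gT},
  [/\ forall x s, h (rc_repr A1 x) s = h x s,
      forall s, rc_repr A1 s = s -> s != 1 -> h 1 s = 1,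
      <<[set h j.1 j.2 | j : X * X]>> = cover_pre p A2
    & forall x s, t2 (cover_val (h x s)) = t1 (a1 x s)].
Proof.
have [e2 ge2] := gen_cover_pre p A2.
pose t (j : edge A1) := t1 (a1 (sval j).1 (sval j).2).
have imE : (t2 \o val) @* cover_pre p A2 = T.
  by rewrite morphim_comp morphpreK ?im_cover_val ?subsetT.
have gt : <<[set t j | j : edge A1]>> = (t2 \o val) @* cover_pre p A2.
  rewrite imE -im_t1; apply/eqP; rewrite eqEsubset gen_subG; apply/andP; split.
    by apply/subsetP=> _ /imsetP[j _ ->]; rewrite mem_morphim.
  apply/subsetP=> _ /morphimP[a _ Aa ->]; apply: mem_gen; apply/imsetP.
  (* An element of [A1] has representative 1, so this edge is off the star and its Schreier
     generator has image [a] in [X]; hence the family [t] generates [T]. *)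
  have aJ : (1, a) \in schreier_edges A1.
    rewrite !inE rc_reprs1 eqxx /= andbT; apply/negP=> /andP[a1n].
    by case/imsetP=> x _ ax; rewrite ax -rc_repr_id -ax rc_repr_in ?eqxx in a1n.
  exists (Sub (1, a) aJ) => //.
  by rewrite /t /a1 /= rc_repr_in // !mul1g rc_repr_in // invg1 mulg1.
have [e1 [ge1 te1]] := gaschutz (subxx _) card_edges ge2 gt.
pose h x s := oapp e1 1 (insub (rc_repr A1 x, s)).
have hx x s : h (rc_repr A1 x) s = h x s by rewrite /h rc_repr_id.
exists h; split=> //.
- move=> s sr s1; rewrite /h insubF // rc_repr_in // !inE eqxx s1 /= -[in X in ~~ X]sr.
  by rewrite imset_f ?inE.
- rewrite -ge1; apply/eqP; rewrite eqEsubset !gen_subG; apply/andP; split.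
    apply/subsetP=> _ /imsetP[[x s] _ ->] /=; rewrite /h.
    by case: insubP => [j _ _|_] /=; rewrite ?group1 // mem_gen // imset_f.
  apply/subsetP=> _ /imsetP[j _ ->]; apply: mem_gen; apply/imsetP.
  exists (sval j) => //; rewrite /h.
  have /imsetP[x _ jx] : (sval j).1 \in rc_reprs A1.
    by case: j => -[q s] /=; rewrite !inE => /and3P[].
  by rewrite jx rc_repr_id -jx -surjective_pairing valK.
- move=> x s; rewrite /h; case: insubP => [j _ jE|] /=.
    by have /= -> := te1 j; rewrite /t jE /a1 rc_repr_id rc_reprMr.
  case/schreier_edgesPn=> r1 rs s1.
  by rewrite (morph1 val) !morph1 /a1 -rc_reprMr r1 !mul1g rs mulgV morph1.
Qed.


(** Reidemeister-Schreier rewriting of [w] read from [x], with the values of [h] substituted for the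
    Schreier generators. *)
Fixpoint edge_eval (h : X -> X -> {perm cover_state X gT}) x (w : seq X) :=
  if w is s :: w' then h x s * edge_eval h (x * s) w' else 1.

Lemma edge_eval_cat h x v w :
  edge_eval h x (v ++ w) = edge_eval h x v * edge_eval h (x * word_prod v) w.
Proof.
elim: v x => [|s v IHv] x /=; first by rewrite /word_prod big_nil mulg1 mul1g.
by rewrite IHv word_prod_cons !mulgA.
Qed.

(** The map rewrites, by means of [h], a word whose product lies in [A1]. It is multiplicative
    because such words return to the base point, onto because the values of [h] generate, and
    injective because both preimages have the same order. The delicate point is independence of the
    chosen word. *)
Lemma cover_pre_iso : exists g : {morphism cover_pre p A1 >-> {perm cover_state X gT}},
  [/\ 'injm g, g @* cover_pre p A1 = cover_pre p A2
    & {in cover_pre p A1, forall a, t2 (cover_val (g a)) = t1 (cover_val a)}].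
Proof.
have [h [hx h1 gh th]] := cover_edges.
have hA x s : h x s \in cover_pre p A2.
  by rewrite -gh mem_gen //; apply/imsetP; exists (x, s).
have hC x s : h x s \in word_group p by apply: subsetP (hA x s); apply: sub_cover_pre.
have hvA x s : cover_val (h x s) \in A2.
  by move: (hA x s); rewrite cover_preE => /andP[].
pose ev := edge_eval h.
have evA w x : ev x w \in cover_pre p A2.
  by elim: w x => [|s w IHw] x /=; [apply: group1 | apply: groupM (hA x s) (IHw _)].
have evC x w : ev x w \in word_group p.
  by apply: subsetP (evA w x); apply: sub_cover_pre.
have evvA x w : cover_val (ev x w) \in A2.
  by move: (evA w x); rewrite cover_preE => /andP[].
have tev w x : t2 (cover_val (ev x w)) = t1 (a1 x (word_prod w)).
  elim: w x => [|s w IHw] x /=.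
    by rewrite (morph1 val) /word_prod big_nil /a1 !mulg1 mulgV !morph1.
  rewrite (@cover_valM _ _ p) // morphM // th IHw -morphM //; congr (t1 _).
  by rewrite word_prod_cons /a1 !mulgA mulgKV.
(* [f (m x)] is the vertex reached from 1 by the rewriting of any word with product [x]. By [kerp]
   it depends, like the coset of [x], only on [p x]. *)
pose m x := t1 (x * (rc_repr A1 x)^-1).
have mT x : m x \in T by rewrite -im_t1 mem_morphim ?mul_rc_reprV.
have mM x s : m (x * s) = m x * t2 (cover_val (h x s)).
  rewrite th -morphM ?mul_rc_reprV //; congr (t1 _).
  by rewrite /a1 !mulgA mulgKV.
have t2T x s : t2 (cover_val (h x s)) \in T by rewrite -im_t2 mem_morphim.
pose r x := odflt 1 [pick y | p y == x].
have pr x : p (r (p x)) = p x.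
  by rewrite /r; case: pickP => [y /eqP //|/(_ x)]; rewrite eqxx.
have [rcr fmr] : (forall x, rc_repr A1 (r (p x)) = rc_repr A1 x)
    /\ (forall x, f (m (r (p x))) = f (m x)).
  have k x : r (p x) * x^-1 \in A1 /\ f (t1 (r (p x) * x^-1)) = 1.
    by apply: kerp; rewrite pM pr -pM mulgV morph1.
  have rcE x : rc_repr A1 (r (p x)) = rc_repr A1 x.
    by rewrite -[r (p x)](mulgKV x) rc_reprM //; case: (k x).
  split=> // x; rewrite /m rcE; have [kA k1] := k x.
  rewrite -[r (p x) in LHS](mulgKV x) -mulgA morphM ?mul_rc_reprV //.
  by rewrite morphM ?k1 ?mul1g // -im_t1 mem_morphim ?mul_rc_reprV.
(* Labelling an edge of the first graph by what its [h]-value reads in [c] turns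
   the action of [ev 1 w] into that of [w], so that [ev 1 w] depends only on the
   image of [w] in [word_group p]. *)
pose pull (c : labelling X gT) x : labelling X gT :=
  [ffun u => cover_label (h (r u.1) u.2) c (x * f (m (r u.1)))].
have pullE c x w y :
    cover_label (ev y w) c (x * f (m y)) = cover_label (word_eval p w) (pull c x) (p y).
  rewrite cover_label_word; elim: w y => [|s w IHw] y /=.
    by rewrite /cover_label perm1.
  rewrite (@cover_labelM _ _ p) // p_A2 // -mulgA -(morphM f (mT y) (t2T y s)).
  rewrite -mM IHw -pM; congr (_ * _).
  by rewrite ffunE /= -[h (r _) _]hx rcr hx fmr.
have m1 : m 1 = 1 by rewrite /m rc_repr_in // mul1g invg1 morph1.
have ev_word v w : word_eval p v = word_eval p w -> ev 1 v = ev 1 w.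
  move=> eqvw; apply: (@eq_word_group _ _ p) => // c x.
  have e u := pullE c x u 1; rewrite m1 morph1 mulg1 in e.
  by rewrite !e eqvw.
have [word wordE] : exists word : {perm cover_state X gT} -> seq X,
    forall a, a \in word_group p -> word_eval p (word a) = a.
  apply: (@fin_all_exists _ (fun=> seq X)
            (fun a w => a \in word_group p -> word_eval p w = a)).
  move=> a; have [/word_groupP[w ->]|] := boolP (a \in word_group p); first by exists w.
  by exists [::].
pose g a := ev 1 (word a).
have gE w : g (word_eval p w) = ev 1 w.
  by apply: ev_word; apply: wordE; apply/word_groupP; exists w.
have ev_step (x y : X) (w : seq X) : rc_repr A1 x = rc_repr A1 y -> ev x w = ev y w.
  elim: w x y => //= s w IHw x y exy; congr (_ * _); first by rewrite -hx exy hx.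
  by apply: IHw; rewrite -rc_reprMr exy rc_reprMr.
have gM : {in cover_pre p A1 &, {morph g : a b / a * b}}.
  move=> a b; rewrite !cover_preE => /andP[/word_groupP[v ->] Aa] /andP[/word_groupP[w ->] Ab].
  rewrite -word_eval_cat !gE /ev edge_eval_cat -/ev mul1g; congr (_ * _).
  by apply: ev_step; move: Aa; rewrite cover_val_word => Av; rewrite !rc_repr_in.
pose gm := Morphism gM.
have gA : {in cover_pre p A1, forall a, t2 (cover_val (g a)) = t1 (cover_val a)}.
  move=> a; rewrite cover_preE => /andP[/word_groupP[w ->]].
  rewrite gE tev cover_val_word => Aw.
  by rewrite /a1 rc_repr_in // !mul1g rc_repr_in // invg1 mulg1.
have im_g : gm @* cover_pre p A1 = cover_pre p A2.
  apply/eqP; rewrite eqEsubset; apply/andP; split.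
    by apply/subsetP=> _ /morphimP[a _ _ ->]; apply: evA.
  rewrite -gh gen_subG; apply/subsetP=> _ /imsetP[[x s] _ ->] /=.
  have ev_im w : word_prod w \in A1 -> ev 1 w \in gm @* cover_pre p A1.
    move=> Aw; rewrite -gE (mem_morphim gm) // cover_preE cover_val_word Aw andbT;
    by apply/word_groupP; exists w.
  pose base x : seq X := if rc_repr A1 x == 1 then [::] else [:: rc_repr A1 x].
  have base_prod y : word_prod (base y) = rc_repr A1 y.
    by rewrite /base /word_prod; case: eqP => [->|_]; rewrite ?big_nil ?big_seq1.
  have ev_base y : ev 1 (base y) = 1.
    rewrite /base /ev; case: eqP => //= /eqP n1.
    by rewrite h1 ?rc_repr_id // mulg1.
  (* The letter [z] closes both paths up in [A1]. Rewriting [base x ++ [:: s; z]] gives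
     [h x s * h y z] and rewriting [base y ++ [:: z]] gives [h y z], so [h x s] is a quotient of two
     elements of the image. *)
  set y := x * s; pose z := (rc_repr A1 y)^-1.
  have prod1 : word_prod (base y ++ [:: z]) \in A1.
    by rewrite word_prod_cat base_prod /word_prod big_seq1 mulgV group1.
  have prod2 : word_prod (base x ++ [:: s; z]) \in A1.
    rewrite word_prod_cat base_prod word_prod_cons /word_prod big_seq1 mulgA.
    by rewrite /z /y -(rc_reprMr A1 x s) mul_rc_reprV.
  have := ev_im _ prod1; have := ev_im _ prod2.
  rewrite /ev !edge_eval_cat -/ev !ev_base !mul1g !base_prod /ev /= !mulg1.
  rewrite !hx -[h (rc_repr A1 x * s) z]hx rc_reprMr hx => I2 I1.
  by rewrite -(mulgK (h y z) (h x s)) groupM ?groupV.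
exists gm; split; [|exact: im_g|exact: gA].
have cA : #|cover_pre p A1| = #|cover_pre p A2|.
  apply: etrans (card_cover_pre p A1) _; apply: etrans (esym (card_cover_pre p A2)).
  by rewrite card_A12.
rewrite -card_im_injm; apply/eqP.
exact: (etrans (congr1 (fun B : {set _} => #|B|) im_g) (esym cA)).
Qed.

End CoverIso.

(** * From an isomorphism of preimages to compatibility *)

Lemma compatible_isog_kers (gT lT1 lT2 : finGroupType) (G : {group gT})
    (L1 : {group lT1}) (L2 : {group lT2})
    (r1 : {morphism G >-> lT1}) (r2 : {morphism G >-> lT2}) :
    r1 @* G = L1 -> r2 @* G = L2 -> 'ker r1 \isog 'ker r2 ->
  compatible L1 L2.
Proof.
move=> im1 im2 kk; exists gT, G, ('ker r1)%G, ('ker r2)%G.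
by split; rewrite ?ker_normal // -?im1 -?im2 isog_sym first_isog.
Qed.

Section Images.

Variables (X gT tT lT1 lT2 : finGroupType) (p : {morphism [set: X] >-> gT}).
Variables (A1 A2 : {group X}).
Variables (t1 : {morphism A1 >-> tT}) (t2 : {morphism A2 >-> tT}).
Variables (T : {group tT}) (f : {morphism T >-> gT}) (K : pred tT).
Variables (l1 : {morphism [set: X] >-> lT1}) (l2 : {morphism [set: X] >-> lT2}).

Lemma comp_cover_valM (lT : finGroupType) (l : {morphism [set: X] >-> lT}) :
  {in word_group p &, {morph (fun a => l (cover_val a)) : a b / a * b}}.
Proof. by move=> a b Ca Cb; rewrite (@cover_valM _ _ p) // morphM ?inE. Qed.

(** Through [t1] and [t2], the same predicate [K] cuts out the kernels of the maps to [L1] and [L2].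
    The isomorphism of [cover_pre_iso] respects [t1] and [t2], so it carries one kernel onto the
    other. *)
Lemma compatible_images (L1 : {group lT1}) (L2 : {group lT2}) :
    l1 @* [set: X] = L1 -> l2 @* [set: X] = L2 ->
    #|A1| = #|A2| -> t1 @* A1 = T -> t2 @* A2 = T ->
    (forall r, p r = 1 -> r \in A1 /\ f (t1 r) = 1) ->
    {in A2, forall a, p a = f (t2 a)} ->
    (forall a, l1 a = 1 -> a \in A1) -> (forall a, l2 a = 1 -> a \in A2) ->
    {in A1, forall a, (l1 a == 1) = K (t1 a)} ->
    {in A2, forall a, (l2 a == 1) = K (t2 a)} ->
  compatible L1 L2.
Proof.
move=> imL1 imL2 cA im1 im2 kerp pA2 k1 k2 K1 K2.
have [g [injg img gt]] := cover_pre_iso cA im1 im2 kerp pA2.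
pose v1 := Morphism (comp_cover_valM l1); pose v2 := Morphism (comp_cover_valM l2).
have im (lT : finGroupType) (l : {morphism [set: X] >-> lT}) :
    l @* [set: X] = Morphism (comp_cover_valM l) @* word_group p.
  apply/setP=> z; apply/morphimP/morphimP => [[s _ _ ->]|[a Ca _ ->]].
    by exists (letter p s); rewrite ?letter_cover //= cover_val_letter.
  by exists (cover_val a); rewrite ?inE.
apply: (@compatible_isog_kers _ _ _ _ _ _ v1 v2); rewrite -?im //.
have s1 : 'ker v1 \subset cover_pre p A1.
  apply/subsetP=> a /[!inE] /andP[Ca /eqP/k1]; by rewrite Ca.
have s2 : 'ker v2 \subset cover_pre p A2.
  apply/subsetP=> a /[!inE] /andP[Ca /eqP/k2]; by rewrite Ca.
suff <- : g @* 'ker v1 = 'ker v2 by apply: sub_isog.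
have kE1 a : a \in cover_pre p A1 -> (a \in 'ker v1) = K (t1 (cover_val a)).
  by rewrite cover_preE => /andP[Ca Aa]; rewrite -K1 // !inE Ca.
have kE2 a : a \in cover_pre p A2 -> (a \in 'ker v2) = K (t2 (cover_val a)).
  by rewrite cover_preE => /andP[Ca Aa]; rewrite -K2 // !inE Ca.
apply/setP=> b; apply/morphimP/idP => [[a Aa ka ->]|kb].
  by rewrite kE2 -?img ?mem_morphim // gt // -kE1.
have := subsetP s2 b kb; rewrite -img => /morphimP[a Aa _ bE].
by exists a => //; rewrite kE1 // -gt // -bE -kE2 // -img bE mem_morphim.
Qed.

End Images.

(** * The fibre product of [L1], [G] and [L2] *)

Section Pullback.

Variables (gT gT1 gT2 qT1 qT2 : finGroupType).
Variables (G : {group gT}) (L1 : {group gT1}) (L2 : {group gT2}).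
Variables (u1 : {morphism G >-> qT1}) (u2 : {morphism G >-> qT2}).
Variables (r1 : {morphism L1 >-> qT1}) (r2 : {morphism L2 >-> qT2}).

Definition pullback_set :=
  [set x : gT1 * gT * gT2 | [&& x.1.1 \in L1, x.1.2 \in G, x.2 \in L2,
                                r1 x.1.1 == u1 x.1.2 & r2 x.2 == u2 x.1.2]].

Lemma pullback_group_set : group_set pullback_set.
Proof.
apply/group_setP; split=> [|x y]; first by rewrite inE !group1 !morph1 !eqxx.
rewrite !inE => /and5P[x1 xG x2 /eqP e1 /eqP e2] /and5P[y1 yG y2 /eqP f1 /eqP f2].
by rewrite !groupM //= !morphM // e1 e2 f1 f2 !eqxx.
Qed.

Definition pullback := Group pullback_group_set.

Local Notation X := (subg_of pullback).

Definition pb_mid_fun (x : X) := (sgval x).1.2.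
Definition pb_left_fun (x : X) := (sgval x).1.1.
Definition pb_right_fun (x : X) := (sgval x).2.
Definition pb_mid := @Morphism _ _ [set: X] pb_mid_fun (fun _ _ _ _ => erefl).
Definition pb_left := @Morphism _ _ [set: X] pb_left_fun (fun _ _ _ _ => erefl).
Definition pb_right := @Morphism _ _ [set: X] pb_right_fun (fun _ _ _ _ => erefl).

Lemma pullbackP (x : X) :
  [/\ pb_left x \in L1, pb_mid x \in G, pb_right x \in L2,
      r1 (pb_left x) = u1 (pb_mid x) & r2 (pb_right x) = u2 (pb_mid x)].
Proof. by have := subgP x; rewrite inE => /and5P[? ? ? /eqP ? /eqP ?]. Qed.

Hypotheses (im1 : r1 @* L1 = u1 @* G) (im2 : r2 @* L2 = u2 @* G).

Lemma pullback_ex l g m : l \in L1 -> g \in G -> m \in L2 ->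
  r1 l = u1 g -> r2 m = u2 g ->
  exists x : X, [/\ pb_left x = l, pb_mid x = g & pb_right x = m].
Proof.
move=> Ll Gg Lm e1 e2.
have Dx : (l, g, m) \in pullback by rewrite inE /= Ll Gg Lm e1 e2 !eqxx.
exists (subg pullback (l, g, m)).
by rewrite /= /pb_left_fun /pb_mid_fun /pb_right_fun subgK.
Qed.

Lemma pb_lift1 g : g \in G -> exists2 l, l \in L1 & r1 l = u1 g.
Proof.
move=> Gg; have : u1 g \in r1 @* L1 by rewrite im1 mem_morphim.
by case/morphimP=> l _ Ll ->; exists l.
Qed.

Lemma pb_lift2 g : g \in G -> exists2 l, l \in L2 & r2 l = u2 g.
Proof.
move=> Gg; have : u2 g \in r2 @* L2 by rewrite im2 mem_morphim.
by case/morphimP=> l _ Ll ->; exists l.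
Qed.

Lemma im_pb_mid : pb_mid @* [set: X] = G.
Proof.
apply/eqP; rewrite eqEsubset; apply/andP; split; apply/subsetP=> g.
  by case/morphimP=> x _ _ ->; case: (pullbackP x).
move=> Gg; have [l Ll e1] := pb_lift1 Gg; have [m Lm e2] := pb_lift2 Gg.
by have [x [_ <- _]] := pullback_ex Ll Gg Lm e1 e2; rewrite mem_morphim ?inE.
Qed.

Lemma im_pb_left : pb_left @* [set: X] = L1.
Proof.
apply/eqP; rewrite eqEsubset; apply/andP; split; apply/subsetP=> l.
  by case/morphimP=> x _ _ ->; case: (pullbackP x).
move=> Ll; have : r1 l \in u1 @* G by rewrite -im1 mem_morphim.
case/morphimP=> g _ Gg e1; have [m Lm e2] := pb_lift2 Gg.
by have [x [<- _ _]] := pullback_ex Ll Gg Lm e1 e2; rewrite mem_morphim ?inE.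
Qed.

Lemma im_pb_right : pb_right @* [set: X] = L2.
Proof.
apply/eqP; rewrite eqEsubset; apply/andP; split; apply/subsetP=> m.
  by case/morphimP=> x _ _ ->; case: (pullbackP x).
move=> Lm; have : r2 m \in u2 @* G by rewrite -im2 mem_morphim.
case/morphimP=> g _ Gg e2; have [l Ll e1] := pb_lift1 Gg.
by have [x [_ _ <-]] := pullback_ex Ll Gg Lm e1 e2; rewrite mem_morphim ?inE.
Qed.

(** The given isomorphisms carry the middle and left components of [A1] into [T], where those of the
    middle and right components of [A2] already lie. The first projection of [T] recovers [pb_mid]
    on [A2], and the second is trivial exactly when the outer component is. *)
Lemma compatible_pullback :
  'ker u1 \isog 'ker u2 -> 'ker r1 \isog 'ker r2 -> compatible L1 L2.
Proof.
move=> ku kr.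
have [phi inj_phi im_phi] := isogP ku; have [th inj_th im_th] := isogP kr.
pose A1 := (pb_mid @*^-1 'ker u1)%G; pose A2 := (pb_mid @*^-1 'ker u2)%G.
have A1I x : pb_mid x \in 'ker u1 -> x \in A1 by move=> k; apply/morphpreP; rewrite inE.
have A2I x : pb_mid x \in 'ker u2 -> x \in A2 by move=> k; apply/morphpreP; rewrite inE.
have A1P x : x \in A1 -> pb_mid x \in 'ker u1 /\ pb_left x \in 'ker r1.
  have [l1 g l2 e1 e2] := pullbackP x; case/morphpreP=> _ k.
  by split=> //; apply/kerP; rewrite // e1; apply/(kerP _ g).
have A2P x : x \in A2 -> pb_mid x \in 'ker u2 /\ pb_right x \in 'ker r2.
  have [l1 g l2 e1 e2] := pullbackP x; case/morphpreP=> _ k.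
  by split=> //; apply/kerP; rewrite // e2; apply/(kerP _ g).
have t1M : {in A1 &, {morph (fun x => (phi (pb_mid x), th (pb_left x))) : x y / x * y}}.
  move=> x y /A1P[kx lx] /A1P[ky ly].
  by rewrite (morphM pb_mid) ?inE // (morphM pb_left) ?inE // !morphM.
have t2M : {in A2 &, {morph (fun x => (pb_mid x, pb_right x)) : x y / x * y}} by [].
pose T := setX ('ker u2) ('ker r2).
have im_t1 : Morphism t1M @* A1 = T.
  apply/setP=> -[g h]; apply/morphimP/setXP => [[x _ /A1P[kx lx] [-> ->]]|[]].
    by rewrite -im_phi -im_th !mem_morphim.
  rewrite -{1}im_phi -{1}im_th => /morphimP[g' _ kg ->] /morphimP[h' _ kh ->].
  have [Gg ug] := (dom_ker kg, mker kg); have [Lh rh] := (dom_ker kh, mker kh).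
  have [m Lm e2] := pb_lift2 Gg.
  have [|x [xl xg _]] := pullback_ex Lh Gg Lm _ e2; first by rewrite ug rh.
  by exists x; [apply: A1I | apply: A1I | ]; rewrite ?xg // -xl -xg.
have im_t2 : Morphism t2M @* A2 = T.
  apply/setP=> -[g h]; apply/morphimP/setXP => [[x _ /A2P[kx lx] [-> ->]]|[kg kh]] //.
  have [Gg ug] := (dom_ker kg, mker kg); have [Lh rh] := (dom_ker kh, mker kh).
  have [l Ll e1] := pb_lift1 Gg.
  have [|x [_ xg xr]] := pullback_ex Ll Gg Lh e1; first by rewrite ug rh.
  by exists x; [apply: A2I | apply: A2I | ]; rewrite ?xg // -xr -xg.
have fM : {in setX_group ('ker u2) ('ker r2) &,
             {morph (fun x : gT * gT2 => x.1) : x y / x * y}} by [].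
apply: (@compatible_images _ _ _ _ _ pb_mid A1 A2 (Morphism t1M) (Morphism t2M)
          _ (Morphism fM) (fun x => x.2 == 1) pb_left pb_right).
- exact: im_pb_left.
- exact: im_pb_right.
- have cA (qT : finGroupType) (u : {morphism G >-> qT}) :
      #|pb_mid @*^-1 'ker u| = (#|'ker pb_mid| * #|'ker u|)%N.
    by rewrite card_morphpre // im_pb_mid subsetIl.
  by apply: etrans (cA _ u1) _; apply: etrans (esym (cA _ u2)); rewrite (card_isog ku).
- exact: im_t1.
- exact: im_t2.
- move=> x x1; split; last by move: x1 => /= ->; rewrite morph1.
  by apply: A1I; rewrite x1 group1.
- by [].
- move=> x x1; apply: A1I; have [_ g _ e _] := pullbackP x.
  by apply/kerP; rewrite // -e x1 morph1.
- move=> x x1; apply: A2I; have [_ g _ _ e] := pullbackP x.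
  by apply/kerP; rewrite // -e x1 morph1.
- move=> x /A1P[_ kx] /=; rewrite (morph_injm_eq1 inj_th) //.
- by [].
Qed.
End Pullback.

(** * Extensions and the nilpotent case *)

Lemma quotient_epi (gT qT : finGroupType) (G N : {group gT}) (Q : {group qT}) :
    N <| G -> G / N \isog Q ->
  exists2 r : {morphism G >-> qT}, 'ker r = N & r @* G = Q.
Proof.
case/andP=> sNG nNG /isogP[f inj_f im_f].
have rM : {in G &, {morph (fun x => f (coset N x)) : x y / x * y}}.
  move=> x y Gx Gy.
  by rewrite !morphM ?mem_quotient ?(subsetP nNG).
exists (Morphism rM).
  apply/setP=> x; rewrite !inE; have [Gx|nGx] /= := boolP (x \in G); last first.
    by apply/esym/negbTE; apply: contra nGx; apply: (subsetP sNG).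
  rewrite morph_injm_eq1 ?mem_quotient //; apply/eqP/idP => [|Nx].
    by move/coset_idr; apply; apply: (subsetP nNG).
  exact: coset_id.
rewrite -im_f; apply/setP=> y.
apply/morphimP/morphimP => [[x _ Gx ->]|[_ /morphimP[x _ Gx ->] _ ->]].
  by exists (coset N x); rewrite ?mem_quotient.
by exists x.
Qed.

Lemma compatible_extension (gT1 gT2 : finGroupType)
    (L1 H1 : {group gT1}) (L2 H2 : {group gT2}) :
    H1 <| L1 -> H2 <| L2 -> H1 \isog H2 -> compatible (L1 / H1) (L2 / H2) ->
  compatible L1 L2.
Proof.
move=> n1 n2 iH [gT [G [M1 [M2 [m1 m2 iM i1 i2]]]]].
have [u1 ku1 iu1] := quotient_epi m1 (isog_refl (G / M1)).
have [u2 ku2 iu2] := quotient_epi m2 (isog_refl (G / M2)).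
have [r1 kr1 ir1] := quotient_epi n1 i1.
have [r2 kr2 ir2] := quotient_epi n2 i2.
apply: (@compatible_pullback _ _ _ _ _ _ _ _ u1 u2 r1 r2).
- by rewrite ir1 iu1.
- by rewrite ir2 iu2.
- by rewrite ku1 ku2.
- by rewrite kr1 kr2.
Qed.

(** ['O_p(G)] is a nontrivial normal Sylow subgroup, so it meets the centre of the nilpotent group
    [G] nontrivially; Cauchy's theorem applies to the intersection. *)
Lemma nilpotent_central_prime (gT : finGroupType) (G : {group gT}) p :
  nilpotent G -> prime p -> p %| #|G| -> exists2 x, x \in 'Z(G) & #[x] = p.
Proof.
move=> nilG pr_p pG; have hallO := nilpotent_pcore_Hall p nilG.
have nt : 'O_p(G) != 1.
  rewrite trivg_card1 (card_Hall hallO) p_part -(exp1n (logn p #|G|)).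
  rewrite eqn_exp2r ?logn_gt0 ?mem_primes ?pr_p ?cardG_gt0 //.
  by rewrite neq_ltn prime_gt1 ?orbT.
have ntZ := meet_center_nil nilG (pcore_normal p G) nt.
have pZ : p.-group ('O_p(G) :&: 'Z(G)).
  by apply: pgroupS (pcore_pgroup p G); apply: subsetIl.
have [_ pdv _] := pgroup_pdiv pZ ntZ.
have [x /setIP[_ Zx] ox] := Cauchy pr_p pdv; by exists x.
Qed.

Lemma compatible_nilpotent (gT1 gT2 : finGroupType)
    (L1 : {group gT1}) (L2 : {group gT2}) :
  #|L1| = #|L2| -> nilpotent L1 -> nilpotent L2 -> compatible L1 L2.
Proof.
have [n] := ubnP #|L1|; elim: n gT1 gT2 L1 L2 => // n IHn.
move=> gT1 gT2 L1 L2 /ltnSE leL eqL nil1 nil2.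
have [L1le1|gt1] := leqP #|L1| 1.
  exists gT1, 1%G, 1%G, 1%G; rewrite normal1 isog_refl.
  by split=> //; apply: trivial_isog => //; [apply: card_le1_trivg | exact: morphim1 |
     apply: card_le1_trivg; rewrite -eqL | exact: morphim1].
have pr_p := pdiv_prime gt1; set p := pdiv _ in pr_p.
have [x1 Z1 o1] := nilpotent_central_prime nil1 pr_p (pdiv_dvd _).
have p2 : p %| #|L2| by rewrite -eqL pdiv_dvd.
have [x2 Z2 o2] := nilpotent_central_prime nil2 pr_p p2.
have n1 : <[x1]> <| L1 by apply: sub_center_normal; rewrite cycle_subG.
have n2 : <[x2]> <| L2 by apply: sub_center_normal; rewrite cycle_subG.
have c1 : #|<[x1]>| = p by []; have c2 : #|<[x2]>| = p by [].
apply: (compatible_extension n1 n2).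
  by rewrite isog_cyclic_card ?cycle_cyclic //= c1 c2.
apply: IHn; rewrite ?quotient_nil //.
  apply: leq_trans leL; rewrite card_quotient ?normal_norm // -divgS ?normal_sub //.
  by rewrite c1 ltn_Pdiv ?prime_gt1 // ltnW.
by rewrite !card_quotient ?normal_norm // -!divgS ?normal_sub // c1 c2 eqL.
Qed.

Theorem corollary6p25 (gT1 gT2 : finGroupType)
    (L1 : {group gT1}) (L2 : {group gT2}) (eq_card : #|L1| = #|L2|) :
  ((exists (N1 : {group gT1}) (N2 : {group gT2}),
      [/\ N1 <| L1, N2 <| L2, N1 \isog N2,
          nilpotent (L1 / N1) & nilpotent (L2 / N2)]) ->
   compatible L1 L2)
  /\ (nilpotent L1 -> nilpotent L2 -> compatible L1 L2).
Proof.
split=> [[N1 [N2 [n1 n2 iN nil1 nil2]]]|]; last exact: compatible_nilpotent.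
apply: (compatible_extension n1 n2 iN); apply: compatible_nilpotent => //.
by rewrite !card_quotient ?normal_norm // -!divgS ?normal_sub // eq_card (card_isog iN).
Qed.
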